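(* Let $M$ be a separable metric space and let $\Sigma$ be an unbounded, boundedly complete, proper subset of $\omega^\omega$. Suppose there is a family $\{K_f: f\in\Sigma\}$ of compact subsets of $M$ such that $M=\bigcup_{f\in\Sigma}K_f$, $K_f\subseteq K_g$ whenever $f\leq g$ in $\Sigma$, and every compact subset of $M$ is contained in some $K_f$ with $f\in\Sigma$. Then $M$ is a Polish space (i.e. $M$ is separable and completely metrizable).
   Context: $\omega^\omega$ is the set of all functions $\omega\to\omega$ with the pointwise order: $f\leq g$ iff $f(n)\leq g(n)$ for all $n\in\omega$. A subset of $\omega^\omega$ is unbounded if it has no upper bound in $\omega^\omega$. A subset $\Sigma\subseteq\omega^\omega$, with the induced order, is boundedly complete if every subset of $\Sigma$ that is bounded in $\omega^\omega$ has an upper bound belonging to $\Sigma$. *)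

(* Defs.v *)
From mathcomp Require Import all_boot all_order all_algebra.
From mathcomp Require Import all_classical all_reals all_analysis.

Set Implicit Arguments.
Unset Strict Implicit.
Unset Printing Implicit Defensive.

Import Order.TTheory GRing.Theory Num.Theory.

Local Open Scope classical_set_scope.
Local Open Scope ring_scope.

Definition separable_space (T : topologicalType) : Prop :=
  exists2 D : set T, countable D & dense D.

Section distances.
Variables (R : realType) (T : Type).
Implicit Types d : T -> T -> R.

(* Nonnegativity follows from these axioms, as in the factory [isMetric]. *)
Definition is_distance d : Prop :=
  [/\ forall x y, d x y = 0 <-> x = y,
      forall x y, d x y = d y x
    & forall y x z, d x z <= d x y + d y z].

Definition dist_cauchy d (u : nat -> T) : Prop :=
  forall e : R, 0 < e -> exists N : nat, forall m n : nat,
    (N <= m)%N -> (N <= n)%N -> d (u m) (u n) < e.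

Definition dist_cvg_to d (u : nat -> T) (l : T) : Prop :=
  forall e : R, 0 < e -> exists N : nat, forall n : nat,
    (N <= n)%N -> d (u n) l < e.

Definition dist_complete d : Prop :=
  forall u : nat -> T, dist_cauchy d u -> exists l : T, dist_cvg_to d u l.

End distances.

Definition induces_topology (R : realType) (T : topologicalType)
    (d : T -> T -> R) : Prop :=
  forall (x : T) (A : set T),
    nbhs x A <-> exists2 e : R, 0 < e & [set y | d x y < e] `<=` A.

(* Not stated with [completeType], which is pointed and so excludes the empty
   space. *)
Definition completely_metrizable (R : realType) (T : topologicalType) : Prop :=
  exists d : T -> T -> R,
    [/\ is_distance d, induces_topology d & dist_complete d].

Definition polish_space (R : realType) (T : topologicalType) : Prop :=
  separable_space T /\ completely_metrizable R T.

(* The order on [nat -> nat] is the pointwise one, see [lefP]. *)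
Definition unbounded (S : set (nat -> nat)) : Prop := ~ has_ubound S.

Definition boundedly_complete (S : set (nat -> nat)) : Prop :=
  forall A : set (nat -> nat), A `<=` S -> has_ubound A ->
    exists2 g, S g & ubound A g.

(* Main.v *)
(* Call [s] good at [x] when every compact set in some ball around [x] lies in
   [K f] for some [f] in [Sigma] with [f <= s] on the first [size s]
   coordinates, and let [V s] be the open set of points at which [s] is good.
   Swallowing gives [V [::] = M].  If no extension of [s] by one coordinate [k]
   is good at [x], the bad compact sets for the various [k] can be chosen to
   shrink to [x]; glued together they form a compact set that is bad for [s], so
   [V s] is covered by the sets [V (rcons s k)].  A Cauchy sequence that is
   eventually in every [V (mkseq a n)] has, by bounded completeness, a
   subsequence inside a single [K g], hence converges.

   Thus in the completion of [M] the points of [M] are those [y] such that, for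
   every [s], [y] in (the open extension of) [V s] implies [y] in some
   [V (rcons s k)].  Each such condition, closed or open, is G_delta, and a
   G_delta subset of a complete metric space is completely metrizable.  The
   completion is bypassed: positive continuous functions [u] on [M] whose
   limit along a Cauchy sequence is [0] when the condition fails are used
   directly to remetrize [M], by adding the variations of [1 / u]. *)
Require Import Defs.
From mathcomp Require Import all_boot all_order all_algebra.
From mathcomp Require Import all_classical all_reals all_analysis.
From mathcomp Require Import lra.

Set Implicit Arguments.
Unset Strict Implicit.
Unset Printing Implicit Defensive.

Local Open Scope classical_set_scope.

Import Order.TTheory GRing.Theory Num.Theory.
Import numFieldNormedType.Exports.
Local Open Scope ring_scope.

(** * Infinite branches, and compact sets shrinking to a point *)

Lemma exists_branch (T : Type) (P : seq T -> Prop) : P [::] ->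
  (forall s, P s -> exists k, P (rcons s k)) ->
  exists a : nat -> T, forall n, P (mkseq a n).
Proof.
move=> P0 PS.
have [k0 _] := PS _ P0.
have /choice[F FP] : forall s, exists k, P s -> P (rcons s k).
  move=> s; have [/PS[k Pk]|nPs] := pselect (P s); first by exists k.
  by exists k0.
pose b n := iter n (fun s => rcons s (F s)) [::].
exists (F \o b) => n.
suff -> : mkseq (F \o b) n = b n by elim: n => //= n; exact: FP.
by elim: n => // n IH; rewrite mkseqS IH.
Qed.

(** A filter that does not cluster at [x] has a member missing some neighbourhood of [x], so it
    lives on finitely many [C k], whose union is compact. *)
Lemma compact_setU1_bigcup (T : topologicalType) (x : T) (C : nat -> set T) :
  (forall k, compact (C k)) ->
  (forall U, nbhs x U -> exists N, forall k, (N <= k)%N -> C k `<=` U) ->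
  compact (x |` \bigcup_k C k).
Proof.
move=> Cc Cx F FF FC.
have [xF|/existsNP[A /existsNP[U /not_implyP[FA /not_implyP[xU AU0]]]]] :=
  pselect (cluster F x).
  by exists x; split => //; left.
have [N CN] := Cx _ xU.
have FN : F (\big[setU/set0]_(i < N) C i).
  apply: filterS (filterI FC FA) => y [[->|[k _ Cky]] Ay].
    by case: AU0; exists x; split => //; exact: nbhs_singleton.
  have [Nk|kN] := leqP N k; last by rewrite -bigcup_mkord; exists k.
  by case: AU0; exists y; split => //; exact: CN Cky.
have [p [Cp Fp]] :=
  @bigsetU_compact T nat C (index_iota 0 N) xpredT (fun i _ => Cc i) F FF
    ltac:(by rewrite big_mkord).
exists p; split=> //; right.
by move: Cp; rewrite big_mkord -bigcup_mkord => -[k _ Ckp]; exists k.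
Qed.

(** * Remetrization by the variations of countably many continuous functions *)

Section separating_functions.
Variables (R : realType) (M : metricType R) (g : nat -> M -> R).

(** The cap [2^-1 ^+ n] makes all but finitely many terms uniformly small, so a supremum can replace
    a series without spoiling continuity. *)
Let q n x y : R := Num.min (2^-1 ^+ n) `|g n x - g n y|.
Let D x y : R := sup (range (fun n => q n x y)).

Let q_le1 n x y : q n x y <= 1.
Proof.
by rewrite ge_min exprn_ile1// invf_le1// ler1n.
Qed.

Let q_leD n x y : q n x y <= D x y.
Proof.
apply: ub_le_sup; last by exists n.
by exists 1 => _ [m _ <-]; exact: q_le1.
Qed.

Let D_le x y c : (forall n, q n x y <= c) -> D x y <= c.
Proof.
by move=> qc; apply: ge_sup; [exists (q 0 x y); exists 0 | move=> _ [n _ <-]].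
Qed.

Let q_ge0 n x y : 0 <= q n x y.
Proof. by rewrite /q le_min normr_ge0 exprn_ge0. Qed.

Let D_ge0 x y : 0 <= D x y.
Proof. exact: le_trans (q_ge0 0 x y) (q_leD _ _ _). Qed.

Let dist x y : R := mdist x y + D x y.

Let dist_is_distance : is_distance dist.
Proof.
split=> [x y|x y|y x z].
- split=> [/eqP|->].
    by rewrite paddr_eq0 ?mdist_ge0// => /andP[/eqP/mdist_positivity].
  rewrite /dist mdistxx add0r; apply/eqP; rewrite eq_le D_ge0 andbT.
  by apply: D_le => n; rewrite /q subrr normr0 ge_min lexx orbT.
- rewrite /dist metric_sym; congr (_ + sup _).
  by apply: eq_imagel => n _; rewrite /q distrC.
- rewrite /dist addrACA lerD ?metric_triangle//; apply: D_le => n.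
  rewrite (le_trans _ (lerD (q_leD n x y) (q_leD n y z)))// /q.
  have := ler_distD (g n y) (g n x) (g n z).
  have := normr_ge0 (g n x - g n y); have := normr_ge0 (g n y - g n z).
  have : 0 <= 2^-1 ^+ n :> R by rewrite exprn_ge0.
  by rewrite /Num.min; do !case: ifP; lra.
Qed.

Hypothesis g_cont : forall n, continuous (g n).

Let dist_nbhs x (e : R) : 0 < e -> nbhs x [set y | dist x y < e].
Proof.
move=> e0.
have e40 : 0 < e / 4 by rewrite divr_gt0.
have [N Ne] : exists N, (2^-1 ^+ N : R) < e / 4.
  have : (fun n => 2^-1 ^+ n : R) @ \oo --> (0 : R).
    by apply: cvg_expr; rewrite ger0_norm// invf_lt1// ltr1n.
  move=> /cvgrPdist_lt/(_ _ e40)[N _ /(_ N (leqnn _))].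
  by rewrite sub0r normrN ger0_norm ?exprn_ge0// => ?; exists N.
have gN : \forall y \near x, forall n, (n < N)%N -> `|g n x - g n y| < e / 4.
  elim: N {Ne} => [|N IH]; first by near=> y.
  have := @g_cont N x; move/cvgrPdist_lt => /(_ _ e40) gN.
  near=> y => n; rewrite ltnS leq_eqVlt => /predU1P[->|]; first by near: y.
  by move: n; near: y.
have dN : \forall y \near x, mdist x y < e / 4.
  by apply/metricType_numDomainType.nbhs_mdistP; exists (e / 4).
near=> y => /=.
have xy : mdist x y < e / 4 by near: y.
suff : D x y <= e / 4 by rewrite /dist; lra.
apply: D_le => n; rewrite ge_min; have [nN|Nn] := ltnP n N.
  apply/orP; right; apply/ltW; move: n nN; near: y; exact: gN.
apply/orP; left; rewrite (le_trans _ (ltW Ne))// ler_wiXn2l//.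
by rewrite invf_le1// ler1n.
Unshelve. all: by end_near. Qed.

Lemma completely_metrizable_by_functions :
  (forall y : nat -> M, dist_cauchy mdist y ->
    (forall n, exists (B : R) N, forall m, (N <= m)%N -> `|g n (y m)| <= B) ->
    exists l, dist_cvg_to mdist y l) ->
  completely_metrizable R M.
Proof.
move=> gcvg; exists dist; split; first exact: dist_is_distance.
  move=> x A; split=> [|[e e0 eA]]; last exact: filterS (dist_nbhs x e0).
  move=> /metricType_numDomainType.nbhs_mdistP[e /= e0 eA]; exists e => // y /=.
  by move=> xy; apply: eA => /=; rewrite (le_lt_trans _ xy)// lerDl.
move=> y yC; have [|n|l yl] := gcvg y.
- move=> e /yC[N yN]; exists N => m n Nm Nn.
  by rewrite (le_lt_trans _ (yN m n Nm Nn))// lerDl.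
(* Below the distance [2^-1 ^+ n] the cap in [q n] is inactive, so [g n] itself varies by at most
   this much along the tail. *)
- have [|N yN] := yC (2^-1 ^+ n); first by rewrite exprn_gt0.
  exists (`|g n (y N)| + 2^-1 ^+ n), N => m Nm.
  have /(le_lt_trans (q_leD n _ _)) : D (y m) (y N) < 2^-1 ^+ n.
    by rewrite (le_lt_trans _ (yN _ _ Nm (leqnn _)))// lerDr mdist_ge0.
  rewrite /q gt_min ltxx/= => /ltW.
  by have := ler_normD (g n (y N)) (g n (y m) - g n (y N)); rewrite subrKC; lra.
(* The limit is one for [mdist]; since [dist]-balls are neighbourhoods, it is also one for
   [dist]. *)
- exists l => e /(dist_nbhs l)/metricType_numDomainType.nbhs_mdistP[r /= r0 re].
  have [N yN] := yl _ r0; exists N => n /yN ynl.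
  have [_ dsym _] := dist_is_distance; rewrite dsym; apply: re => /=.
  by rewrite metric_sym.
Qed.

End separating_functions.

(** * Depth of a point in a family of sets, and trees of open sets *)

Section depth.
Variables (R : realType) (M : metricType R).
Implicit Types (A : set (set M)) (x y : M).

(* Balls of nonpositive radius are empty, so [0] belongs to this set when [A]
   is nonempty. *)
Definition depth A x : R :=
  sup [set r | r <= 1 /\ exists2 U, A U & ball x r `<=` U].

Let has_ubound_depth A x :
  has_ubound [set r : R | r <= 1 /\ exists2 U, A U & ball x r `<=` U].
Proof. by exists 1 => r []. Qed.

Let depth_nonempty A x : A !=set0 ->
  [set r : R | r <= 1 /\ exists2 U, A U & ball x r `<=` U] !=set0.
Proof.
move=> [U AU]; exists 0; split => //; exists U => // y.
by rewrite ballEmdist/= ltNge mdist_ge0.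
Qed.

Lemma le_depth A U x r : A U -> r <= 1 -> ball x r `<=` U -> r <= depth A x.
Proof.
by move=> AU r1 xU; apply: ub_le_sup => //; split => //; exists U.
Qed.

Lemma depth_le1 A x : A !=set0 -> depth A x <= 1.
Proof.
by move=> A0; apply: ge_sup => [|r []//]; exact: depth_nonempty.
Qed.

Lemma lt_depth A x r : A !=set0 -> r < depth A x ->
  exists2 U, A U & ball x r `<=` U.
Proof.
move=> A0; rewrite /depth => /sup_gt[|s [s1 [W AW xW]] rs].
  exact: depth_nonempty.
by exists W => //; apply: subset_trans xW; apply: le_ball; exact: ltW.
Qed.

Lemma depth_gt0_ex A x : A !=set0 -> 0 < depth A x -> exists2 U, A U & U x.
Proof.
move=> A0 Ax; have [|U AU xU] := @lt_depth A x (depth A x / 2) A0; first by lra.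
by exists U => //; apply: xU; apply: ballxx; lra.
Qed.

Lemma depth_mono A B x : A !=set0 -> A `<=` B -> depth A x <= depth B x.
Proof.
move=> A0 AB; apply: ge_sup => [|r [r1 [U AU xU]]]; first exact: depth_nonempty.
by apply: le_depth r1 xU; exact: AB.
Qed.

Lemma depth_lipschitz A x y : A !=set0 -> depth A x <= depth A y + mdist x y.
Proof.
move=> A0; apply: ge_sup => [|r [r1 [W AW xW]]]; first exact: depth_nonempty.
rewrite -lerBlDr; apply: (@le_depth A W) => //.
  by rewrite lerBlDr (le_trans r1)// lerDl mdist_ge0.
move=> z; rewrite ballEmdist/= => yz; apply: xW; rewrite ballEmdist/=.
by rewrite (le_lt_trans (metric_triangle x y z))// -ltrBrDl.
Qed.

Lemma continuous_depth A : A !=set0 -> continuous (depth A).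
Proof.
move=> A0 x; apply/cvgrPdist_lt => e e0.
apply/metricType_numDomainType.nbhs_mdistP; exists e => // y /= xy.
have := @depth_lipschitz A x y A0; have := @depth_lipschitz A y x A0.
by rewrite (metric_sym y) ltr_norml => ? ?; apply/andP; split; lra.
Qed.

(** One [U] serves the whole tail: it contains the ball of radius [d / 2] around a late term [y p],
    and later terms stay within [d / 4] of [y p]. *)
Lemma depth_eventually A (y : nat -> M) (d : R) : 0 < d -> A !=set0 ->
  dist_cauchy mdist y ->
  (exists N, forall m, (N <= m)%N -> d <= depth A (y m)) ->
  exists2 U, A U &
    exists N, forall m, (N <= m)%N -> d / 4 <= depth [set U] (y m).
Proof.
move=> d0 A0 yC [N dN]; have [|N' yN'] := yC (d / 4); first by rewrite divr_gt0.
pose p := maxn N N'; have dp := dN p (leq_maxl _ _).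
have [|U AU pU] := @lt_depth A (y p) (d / 2) A0; first by lra.
exists U => //; exists N' => m Nm.
have U0 : [set U] !=set0 by exists U.
have : d / 2 <= depth [set U] (y p).
  by apply: (@le_depth _ U) => //; have := depth_le1 (y p) A0; lra.
have := depth_lipschitz (y p) (y m) U0.
have := yN' p m (leq_maxr _ _) Nm.
lra.
Qed.

Lemma depth_gt0 U x : open U -> U x -> 0 < depth [set U] x.
Proof.
move=> oU Ux; have /nbhs_ballP[e /= e0 eU] := open_nbhs_nbhs (conj oU Ux).
rewrite (@lt_le_trans _ _ (Num.min 1 e)) ?lt_min ?ltr01//.
apply: (@le_depth _ U) => //; first by rewrite ge_min lexx.
by apply: subset_trans eU; apply: le_ball; rewrite ge_min lexx orbT.
Qed.

End depth.

(** Boundedness of the functions [(u i)^-1] along a Cauchy sequence selects a branch [a] such that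
    each [V (mkseq a n)] contains a tail; [Vcvg] then applies. *)
Lemma completely_metrizable_by_open_tree (R : realType) (M : metricType R)
    (V : seq nat -> set M) :
  (forall s, open (V s)) -> V [::] = setT ->
  (forall s, V s `<=` \bigcup_k V (rcons s k)) ->
  (forall (y : nat -> M) (a : nat -> nat), dist_cauchy mdist y ->
    (forall n, exists N, forall m, (N <= m)%N -> V (mkseq a n) (y m)) ->
    exists l, dist_cvg_to mdist y l) ->
  completely_metrizable R M.
Proof.
move=> Vo V0 VS Vcvg.
pose f s : M -> R := depth [set V s].
pose h s : M -> R := depth (range (fun k => V (rcons s k))).
have f0 s : [set V s] !=set0 by exists (V s).
have h0 s : range (fun k => V (rcons s k)) !=set0.
  by exists (V (rcons s 0)); exists 0.
(* Along a Cauchy sequence, every [u (s, j)] stays away from [0] if and only if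
   [f s] tends to [0] or [h s] stays away from [0]. *)
pose u (i : seq nat * nat) x : R := Num.max (i.2.+1%:R^-1 - f i.1 x) (h i.1 x).
have u_gt0 i x : 0 < u i x.
  rewrite lt_max; have [fx|fx] := leP (f i.1 x) 0.
    by rewrite (lt_le_trans _ (lerB (lexx _) fx))// subr0 invr_gt0 ltr0n.
  have [_ -> /VS[k _ Vx]] := depth_gt0_ex (f0 _) fx.
  apply/orP; right; apply: (lt_le_trans (depth_gt0 (Vo _) Vx)).
  by apply: depth_mono; [exact: f0|move=> _ ->; exists k].
have u_cont i : continuous (u i).
  move=> x; apply: (@continuous_max R M (fun z => _ - f i.1 z) (h i.1) x);
    last exact: continuous_depth.
  by apply: cvgB; [exact: cvg_cst|exact: continuous_depth].
(* Codes of no pair get a default index, which only repeats one of the functions. *)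
pose I n := odflt ([::], 0%N) (unpickle n) : seq nat * nat.
apply: (@completely_metrizable_by_functions _ _ (fun n x => (u (I n) x)^-1)).
  by move=> n x; apply: cvgV; [rewrite gt_eqF|exact: u_cont].
move=> y yC uB.
pose P s := exists2 d : R, 0 < d &
  exists N, forall m, (N <= m)%N -> d <= f s (y m).
have [||a aP] := @exists_branch nat P.
- exists 1 => //; exists 0 => m _; apply: (@le_depth _ _ _ (V [::])) => //.
  by rewrite V0.
- move=> s [d d0 [N dN]].
  (* With this [j] the first argument of the maximum in [u (s, j)] is negative on the tail, so the
     bound [B^-1 <= u (s, j)] must come from [h s]. *)
  have [j jd] : exists j, j.+1%:R^-1 < d.
    have [j _ /(_ j (leqnn j))] := near_infty_natSinv_lt (PosNum d0).
    by exists j.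
  have [B [N' BN']] := uB (pickle (s, j)).
  have B0 : 0 < B.
    by apply: lt_le_trans (BN' _ (leqnn _)); rewrite normr_gt0 invr_eq0 gt_eqF.
  have B10 : 0 < B^-1 by rewrite invr_gt0.
  have [|_ [k _ <-] kf] := depth_eventually B10 (h0 s) yC; last first.
    by exists k, (B^-1 / 4) => //; rewrite divr_gt0.
  exists (maxn N N') => m; rewrite geq_max => /andP[/dN dm /BN'].
  rewrite /I pickleK/= normfV gtr0_norm// -{1}(invrK B) lef_pV2 ?posrE//.
  rewrite /u/= le_max.
  case/orP => // /(lt_le_trans B10)/lt_le_trans /(_ (lerB (lexx _) dm)).
  by rewrite subr_gt0 ltNge (ltW jd).
apply: (Vcvg y a yC) => n; have [d d0 [N dN]] := aP n.
exists N => m /dN dm.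
by have [_ ->] := depth_gt0_ex (f0 (mkseq a n)) (lt_le_trans d0 dm).
Qed.

(** * Convergence and the open tree given by the compact family *)

Lemma cauchy_cvg_subsequence_in_compact (R : realType) (M : metricType R)
    (C : set M) (y : nat -> M) (w : nat -> nat) :
  compact C -> dist_cauchy mdist y -> (forall n, (n <= w n)%N) ->
  (forall n, C (y (w n))) -> exists l, dist_cvg_to mdist y l.
Proof.
move=> Cc yC wn Cyw.
have [|l [_ yl]] := Cc ((y \o w) @ \oo).
  by exists 0%N => // n _; exact: Cyw.
exists l => e e0; have e20 : 0 < e / 2 by rewrite divr_gt0.
have [N yN] := yC _ e20; exists N => m Nm.
have [|_ [[n /= Nn <-] lyn]] :=
  yl ((y \o w) @` [set n | (N <= n)%N]) _ _ (nbhsx_ballx l _ e20).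
  by exists N => // n /= Nn; exists n.
move: lyn; rewrite ballEmdist/= metric_sym => lyn.
have := yN m (w n) Nm (leq_trans Nn (wn n)).
by have := metric_triangle (y m) (y (w n)) l; lra.
Qed.

Theorem theorem3p5 (R : realType) (M : metricType R)
    (Sigma : set (nat -> nat)) (K : (nat -> nat) -> set M)
    (M_separable : separable_space M)
    (Sigma_unbounded : unbounded Sigma)
    (Sigma_bcomplete : boundedly_complete Sigma)
    (Sigma_proper : Sigma `<` [set: nat -> nat])
    (K_compact : forall f, Sigma f -> compact (K f))
    (K_cover : [set: M] = \bigcup_(f in Sigma) K f)
    (K_mono : forall f g, Sigma f -> Sigma g -> (f <= g)%O -> K f `<=` K g)
    (K_swallow : forall C : set M, compact C -> exists2 f, Sigma f & C `<=` K f) :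
  polish_space R M.
Proof.
split=> //.
pose below f s := forall i, (i < size s)%N -> (f i <= nth 0 s i)%N.
pose swallowed s C := exists f, [/\ Sigma f, below f s & C `<=` K f].
pose V s : set M := [set x | exists2 e : R, 0 < e &
  forall C, compact C -> C `<=` ball x e -> swallowed s C].
apply: (@completely_metrizable_by_open_tree _ _ V).
- move=> s; rewrite openE => x [e e0 xe]; apply/nbhs_ballP.
  exists (e / 2) => /=; first by lra.
  move=> z xz; exists (e / 2); first by lra.
  move=> C Cc Cz; apply: xe => // t /Cz zt; rewrite [e]splitr.
  exact: ball_triangle xz zt.
- apply/seteqP; split => // x _; exists 1 => // C /K_swallow[f Sf Cf] _.
  by exists f; split.
- move=> s x [e e0 xe]; apply: contrapT => nVx.
  have /choice[C CP] : forall k, exists C,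
      [/\ compact C, C `<=` ball x (Num.min e k.+1%:R^-1)
        & ~ swallowed (rcons s k) C].
    move=> k; apply: contrapT => nC; apply: nVx; exists k => //.
    exists (Num.min e k.+1%:R^-1); first by rewrite lt_min e0 invr_gt0 ltr0n.
    by move=> C Cc Cx; apply: contrapT => nCk; apply: nC; exists C.
  have [||f [Sf fs Cf]] := xe (x |` \bigcup_k C k).
  + apply: compact_setU1_bigcup => [k|U /nbhs_ballP[r /= r0 rU]].
      by have [] := CP k.
    have [N _ Nr] := near_infty_natSinv_lt (PosNum r0).
    exists N => k Nk; have [_ Ck _] := CP k.
    apply: subset_trans rU; apply: subset_trans Ck _; apply: le_ball.
    by rewrite ge_min (ltW (Nr k Nk)) orbT.
  + move=> z [->|[k _ Ckz]]; first exact: ballxx.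
    have [_ Ck _] := CP k; apply: le_ball (Ck _ Ckz).
    by rewrite ge_min lexx.
  (* The value of [f] at the new coordinate is the [k] for which [f] swallows a set chosen to be
     bad. *)
  + have [_ _ []] := CP (f (size s)); exists f; split=> //.
      move=> i; rewrite size_rcons ltnS nth_rcons.
      by case: ltngtP => // [/fs//|->].
    by apply: subset_trans Cf => z Cz; right; exists (f (size s)).
- move=> y a yC yV.
  have /choice[w wP] : forall n, exists m, (n <= m)%N /\ V (mkseq a n) (y m).
    move=> n; have [N yN] := yV n; exists (maxn n N).
    by split; [exact: leq_maxl|apply: yN; exact: leq_maxr].
  have /choice[f fP] : forall n, exists f,
      [/\ Sigma f, below f (mkseq a n) & K f (y (w n))].
    move=> n; have [_ [e e0 we]] := wP n.
    have [|f [Sf fa Kf]] := we [set y (w n)] (@compact_set1 _ _).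
      by move=> _ ->; exact: ballxx.
    by exists f; split => //; exact: Kf.
  have [||g Sg gf] := Sigma_bcomplete (range f).
  + by move=> _ [n _ <-]; have [] := fP n.
  (* At coordinate [i], the term [a i] bounds every [f n] with [i < n]; the sum takes care of the
     finitely many [n <= i]. *)
  + exists (fun i => a i + \sum_(n < i.+1) f n i)%N => _ [n _ <-].
    apply/lefP => i; rewrite leEnat; have [ni|i_n] := leqP n i.
      by rewrite (bigD1 (Ordinal (ni : n < i.+1)%N))//= addnCA leq_addr.
    have [_ /(_ i) fa _] := fP n.
    move: fa; rewrite size_mkseq nth_mkseq// => /(_ i_n)/leq_trans.
    by apply; exact: leq_addr.
  apply: (@cauchy_cvg_subsequence_in_compact _ _ (K g) y w) => // [|n|n].
  + exact: K_compact.
  + by have [] := wP n.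
  + by have [Sf _ Kf] := fP n; apply: K_mono Kf => //; apply: gf; exists n.
Qed.
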